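(* Let $d\ge 1$ and $k\ge 2$ be integers. Let $\vec w^1,\ldots,\vec w^k\in\mathbb N^d$ satisfy $\gcd(w^1_i,\ldots,w^k_i)=1$ for all $i=1,\ldots,d$, and let $p_1,\ldots,p_k$ be positive reals with $\sum_{j=1}^k p_j=1$. Let $Y=Y(\vec w^1,\ldots,\vec w^k)$ be the $\vec w^1,\ldots,\vec w^k$ domino tiling shift and let $\mathcal A$ be its alphabet. Then, given any free, measure preserving $\mathbb Z^d$ action $T$ on a Lebesgue probability space $(X,\mathcal M,\mu)$, there is a measurable map (partition) $\phi:X\to\mathcal A$ such that for $\mu$-a.e. $x\in X$ there is a point $y_x\in Y$ with $$\phi(T^{\vec v}x)=y_x[\vec v]\quad\text{for all }\vec v\in\mathbb Z^d,$$ and such that for $j=1,\ldots,k$ $$\mu(\phi^{-1}(\tau^j))<\min_{i=1,\ldots,k}p_i .$$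
   Context: $\mathbb N=\{1,2,\ldots\}$. For $\vec w\in\mathbb N^d$, $R_{\vec w}=\prod_{i=1}^d\{0,1,\ldots,w_i-1\}\subset\mathbb Z^d$. Given $\vec w^1,\ldots,\vec w^k\in\mathbb N^d$, let $\vec W\in\mathbb N^d$ be given by $W_i=\prod_{j=1}^k w^j_i$. There are $k+1$ domino types: $\tau^1,\ldots,\tau^k$, where $\tau^j$ has shape $R_{\vec w^j}$, and the large domino $\tau^P$, of shape $R_{\vec W}$ (these $k+1$ types are distinct as labels even if shapes coincide). The alphabet is $$\mathcal A=\{\tau^j_{\vec v}:1\le j\le k,\ \vec v\in R_{\vec w^j}\}\cup\{\tau^P_{\vec v}:\vec v\in R_{\vec W}\}.$$ The domino tiling shift $Y=Y(\vec w^1,\ldots,\vec w^k)\subset\mathcal A^{\mathbb Z^d}$ is the shift of finite type coding all tilings of $\mathbb Z^d$ by translates of these dominos, where each cell carries the type of the domino covering it and its position inside that domino. Explicitly, $y\in Y$ iff for every $\vec n\in\mathbb Z^d$, writing $y[\vec n]=\tau^a_{\vec v}$ with $a\in\{1,\ldots,k,P\}$ and $R$ the shape of $\tau^a$, one has $y[\vec n-\vec v+\vec u]=\tau^a_{\vec u}$ for all $\vec u\in R$. Here $y[\vec n]$ is the symbol of $y$ at position $\vec n$. The notation $\phi^{-1}(\tau^j)$ means $\bigcup_{\vec v\in R_{\vec w^j}}\phi^{-1}(\{\tau^j_{\vec v}\})$. A Lebesgue probability space is a standard non-atomic probability space; a measure preserving $\mathbb Z^d$ action $T$ is free if for a.e.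 $x$, $T^{\vec v}x\ne x$ for all $\vec v\neq\vec 0$. The action is not assumed ergodic. *)

(* Defs.v *)
From HB Require Import structures.
From mathcomp Require Import all_boot all_order all_algebra.
From mathcomp Require Import all_classical all_reals all_analysis.
From mathcomp Require Import measurable_realfun.

Set Implicit Arguments.
Unset Strict Implicit.
Unset Printing Implicit Defensive.

Import Order.TTheory GRing.Theory Num.Theory.

Local Open Scope classical_set_scope.
Local Open Scope ring_scope.

Section DominoShift.
Variables (d k : nat) (w : 'I_k -> 'I_d -> nat).

(* [Some j] is the label of the small domino $\tau^j$, [None] that of the
   large domino $\tau^P$. *)
Definition domino := option 'I_k.

Definition domino_shape (a : domino) (i : 'I_d) : nat :=
  if a is Some j then w j i else (\prod_(j < k) w j i)%N.

Definition box (s : 'I_d -> nat) := {dffun forall i : 'I_d, 'I_(s i)}.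

Definition box_pos (s : 'I_d -> nat) (v : box s) : 'rV[int]_d :=
  \row_i (v i)%:Z.

Definition domino_alphabet := {a : domino & box (domino_shape a)}.

Definition domino_cell (a : domino) (v : box (domino_shape a)) :
  domino_alphabet := Tagged (fun b => box (domino_shape b)) v.

Definition domino_shift : set ('rV[int]_d -> domino_alphabet) :=
  [set y | forall (n : 'rV[int]_d) (a : domino) (v : box (domino_shape a)),
     y n = domino_cell v ->
     forall u : box (domino_shape a),
       y (n - box_pos v + box_pos u) = domino_cell u].

End DominoShift.

Arguments domino_cell {d k} w a v.
Arguments domino_shift {d k} w.

Section Dynamics.
Context (disp : measure_display) (X : measurableType disp) (R : realType).
Variable mu : probability X R.

(* Standardness in the sense of Rokhlin: after completion, [X] is isomorphic
   mod 0 to the real line with a Borel probability measure.  Images of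
   measurable sets are only required to be measurable for the completion of the
   image measure, so that both Borel and complete sigma-algebras on [X] are
   covered. *)
Definition standard_probability : Prop :=
  exists (X0 : set X) (f : {RV mu >-> R}),
    [/\ measurable X0, mu X0 = 1%E, set_inj X0 f &
      forall A : set X, measurable A -> A `<=` X0 ->
        completed_algebra_gen (distribution mu f) (f @` A)].

Definition non_atomic : Prop :=
  forall A : set X, measurable A -> (0 < mu A)%E ->
    exists B : set X, [/\ measurable B, B `<=` A & (0 < mu B < mu A)%E].

Definition lebesgue_probability : Prop := standard_probability /\ non_atomic.

Variables (d : nat) (T : 'rV[int]_d -> X -> X).

Definition measure_preserving_action : Prop :=
  [/\ forall x, T 0 x = x,
      forall u v x, T (u + v) x = T u (T v x),
      forall v, measurable_fun setT (T v) &
      forall v (A : set X), measurable A -> mu (T v @^-1` A) = mu A].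

Definition free_action : Prop :=
  {ae mu, forall x, forall v : 'rV[int]_d, v != 0 -> T v x != x}.

End Dynamics.

(* Measurability for the discrete sigma-algebra on the target. *)
Definition measurable_partition (disp : measure_display)
    (X : measurableType disp) (S : Type) (phi : X -> S) : Prop :=
  forall B : set S, measurable (phi @^-1` B).

(* Main.v *)
Require Import Defs.
From HB Require Import structures.
From mathcomp Require Import all_boot all_order all_algebra.
From mathcomp Require Import all_classical all_reals all_analysis.
From mathcomp Require Import zify lra.

Set Implicit Arguments.
Unset Strict Implicit.
Unset Printing Implicit Defensive.

Import Order.TTheory GRing.Theory Num.Theory.

Local Open Scope classical_set_scope.
Local Open Scope ring_scope.

(** Almost every orbit is covered, up to an arbitrarily small proportion, by
    disjoint large cubes of bounded size (as in Ornstein and Weiss: take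
    a maximal disjoint family of huge cubes, then one of much smaller cubes in
    what is left, and so on; each round removes a definite proportion of the
    rest).  Do this for sizes growing fast with [n].  The cubes of stage [n + 1]
    are tiled by large dominos along a grid attached to their corner, except
    that the tilings of the cubes of stage [n] lying well inside are kept.  Such
    a cube is aligned with another grid, and the gap between the two grids can
    be bridged in a shell of bounded thickness by small dominos alone: move one
    coordinate at a time, filling slabs whose thickness is a combination of the
    [w j i] (as the gcd is 1) and whose other sides are multiples of all of them.
    By Borel-Cantelli the tilings stabilize almost everywhere, and small dominos
    occur only near the boundaries of the cubes, a set of small measure. *)

(** * Tilings of boxes and frames *)

(** A Bezout relation yields two consecutive elements [m] and [m + 1] of [S]; their combinations
    reach every number from [m * m] on. *)
Lemma semigroup_large (I : Type) (r : seq I) (a : I -> nat) (S : nat -> Prop) :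
  S 0%N -> (forall m n, S m -> S n -> S (m + n)%N) ->
  (forall i, (0 < a i)%N /\ S (a i)) -> \big[gcdn/0%N]_(i <- r) a i = 1%N ->
  exists C, forall n, (C <= n)%N -> S n.
Proof.
move=> S0 SD Sa g1.
have SM q n : S n -> S (q * n)%N by move=> Sn; elim: q => [//|q IH]; exact: SD.
have [m [Sm Sm1]] : exists m, S m /\ S (m + 1)%N.
  rewrite -g1 {g1}; elim: r => [|i r [m [Sm Sg]]].
    by exists 0%N; rewrite big_nil.
  rewrite big_cons; set g := \big[_/_]_(_ <- _) _ in Sg *.
  have [u v uv _] := egcdnP g (Sa i).1.
  exists (v * (m + g))%N; split; first exact: SM.
  have -> : (v * (m + g) + gcdn (a i) g = v * m + u * a i)%N by lia.
  by apply: SD; apply: SM => //; case: (Sa i).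
case: (posnP m) => [m0|m0].
  by exists 0%N => n _; rewrite -[n]muln1; apply: SM; rewrite m0 in Sm1.
exists (m * m)%N => n mn.
have qr : (n %% m <= n %/ m)%N.
  by rewrite (leq_trans (ltnW (ltn_pmod _ m0))) // leq_divRL.
(* The remainder is absorbed by using [m + 1] in place of [m] that many times; there are enough
   copies because [n %% m <= n %/ m]. *)
have -> : n = ((n %/ m - n %% m) * m + n %% m * (m + 1))%N.
  rewrite {1}(divn_eq n m); nia.
by apply: SD; exact: SM.
Qed.

Section Geometry.
Variables (d k : nat) (w : 'I_k -> 'I_d -> nat).
Hypothesis w_gt0 : forall j i, (0 < w j i)%N.

Local Notation vec := 'rV[int]_d.
Local Notation shape a i := (domino_shape w a i).

Lemma shape_gt0 a i : (0 < shape a i)%N.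
Proof. by case: a => [j|] //=; rewrite prodn_gt0. Qed.

(* The coordinates of [c] are reduced modulo the side lengths, so [c] may be the
   position relative to any corner of a grid of dominos. *)
Definition cell a (c : vec) : domino_alphabet w :=
  domino_cell w a
    [ffun i : 'I_d => Ordinal (ltn_pmod `|(c 0%R i %% shape a i)%Z| (shape_gt0 a i))].

Lemma eq_cell a (c c' : vec) :
  (forall i, (c 0%R i = c' 0%R i %[mod shape a i])%Z) -> cell a c = cell a c'.
Proof.
by move=> cc'; congr domino_cell; apply/ffunP => i; rewrite !ffunE cc'.
Qed.

Definition ibox (lo hi : 'I_d -> int) : set vec :=
  [set v | forall i, lo i <= v 0 i < hi i].

Definition dominoset a (c : vec) : set vec :=
  ibox (c 0) (fun i => c 0 i + (shape a i)%:Z).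

(** Confining the domino to [S] makes the notion local, so that tilings of disjoint sets can be
    glued. *)
Definition covered (S : set vec) (y : vec -> domino_alphabet w) (n : vec) :=
  exists a c, [/\ dominoset a c n, dominoset a c `<=` S &
    forall m, dominoset a c m -> y m = cell a (m - c)].

Lemma covered_shift y : (forall n, covered setT y n) -> domino_shift w y.
Proof.
move=> cov n a v yn u; have [a' [c [cn _ yc]]] := cov n.
have := yc _ cn; rewrite yn => e.
have ea : a' = a by case: e.
subst a'; move/eqP: e; rewrite eq_Tagged /= => /eqP vE.
have posE i : (v i)%:Z = n 0 i - c 0 i.
  have := cn i; rewrite vE ffunE /= !mxE; move: (n 0 i) (c 0 i) => x z h.
  by rewrite modz_small ?modn_small; lia.
have mem : dominoset a c (n - box_pos v + box_pos u).
  move=> i; rewrite !mxE posE; have := ltn_ord (u i).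
  by move: (n 0 i) (c 0 i) (nat_of_ord (u i)) => x z t; lia.
rewrite yc //; congr Tagged; apply/ffunP => i; apply/val_inj.
rewrite !ffunE /= !mxE posE.
have -> : n 0 i - (n 0 i - c 0 i) + (u i)%:Z - c 0 i = (u i)%:Z.
  by move: (n 0 i) (c 0 i) (nat_of_ord (u i)) => x z t; lia.
have := ltn_ord (u i); move: (nat_of_ord (u i)) => t ts.
by rewrite modz_small ?modn_small; lia.
Qed.

Lemma covered_sub (S S' : set vec) y y' n : S `<=` S' ->
  {in S, y =1 y'} -> covered S y n -> covered S' y' n.
Proof.
move=> SS' yy' [a [c [cn cS yc]]]; exists a, c; split=> //.
  exact: subset_trans SS'.
by move=> m cm; rewrite -yy' ?yc// inE; exact: cS.
Qed.

(** Lower corner of the tile containing [n], in the grid of dominos of type [a] that has a corner at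
    [b]. *)
Definition grid_corner a (b n : vec) : vec :=
  \row_i (n 0 i - ((n 0%R i - b 0%R i) %% shape a i)%Z).

Lemma grid_corner_mem a b n : dominoset a (grid_corner a b n) n.
Proof.
move=> i; rewrite !mxE; have := shape_gt0 a i.
move: (n 0 i) (b 0 i) (shape a i) => x z s s0; lia.
Qed.

Lemma covered_grid a b (S : set vec) y n :
  dominoset a (grid_corner a b n) `<=` S ->
  (forall m, dominoset a (grid_corner a b n) m -> y m = cell a (m - b)) ->
  covered S y n.
Proof.
move=> gS yg; exists a, (grid_corner a b n); split=> //.
  exact: grid_corner_mem.
move=> m /yg ->; apply: eq_cell => i; rewrite !mxE.
apply/eqP; rewrite eqz_mod_dvd.
have -> : m 0 i - b 0 i - (m 0 i - (n 0 i - ((n 0%R i - b 0%R i) %% (shape a i))%Z))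
  = ((n 0%R i - b 0%R i) %/ (shape a i))%Z * shape a i.
  by have := divz_eq (n 0 i - b 0 i) (shape a i); lia.
by rewrite dvdz_mull.
Qed.

(** All faces of the box lie on grid hyperplanes, so no tile crosses its boundary. *)
Lemma grid_corner_sub_ibox a (b n : vec) lo hi :
  (forall i, (shape a i %| lo i - b 0%R i)%Z /\ (shape a i %| hi i - lo i)%Z) ->
  ibox lo hi n -> dominoset a (grid_corner a b n) `<=` ibox lo hi.
Proof.
move=> dv nb m mg i; have := mg i; have := nb i; have [] := dv i.
rewrite !mxE; have := shape_gt0 a i.
move: (shape a i) (lo i) (hi i) (b 0 i) (n 0 i) (m 0 i) => s l h z x t s0.
move=> /dvdzP [q1 e1] /dvdzP [q2 e2] xlh.
have -> : ((x - z) %% s)%Z = ((x - l) %% s)%Z.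
  have -> : x - z = q1 * s + (x - l) by lia.
  by rewrite modzMDl.
have := divz_eq (x - l) s; set q := ((x - l) %/ s)%Z; set r := ((x - l) %% s)%Z.
have r0 : 0 <= r by rewrite modz_ge0; lia.
have rs : r < s by rewrite ltz_pmod; lia.
move=> e te.
have q0 : 0 <= q by nia.
have qq : q + 1 <= q2 by nia.
by nia.
Qed.

Definition tileable (S : set vec) := exists y, forall n, S n -> covered S y n.

Lemma tileable0 : tileable set0.
Proof. by exists (fun=> cell None 0). Qed.

Lemma tileableU S1 S2 : S1 `&` S2 = set0 ->
  tileable S1 -> tileable S2 -> tileable (S1 `|` S2).
Proof.
move=> S12 [y1 c1] [y2 c2].
exists (fun n => if n \in S1 then y1 n else y2 n) => n [/c1|/c2] cn.
  by apply: covered_sub cn => // m ->.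
apply: covered_sub cn => // m; rewrite inE => S2m; case: ifPn => //.
rewrite inE => S1m.
by have : (S1 `&` S2) m by []; rewrite S12.
Qed.

Lemma tileable_ibox_dvd a lo hi :
  (forall i, (shape a i %| hi i - lo i)%Z) -> tileable (ibox lo hi).
Proof.
move=> dv; exists (fun n => cell a (n - \row_i lo i)) => n nb.
apply: (@covered_grid a (\row_i lo i)) => //.
by apply: grid_corner_sub_ibox nb => i; rewrite mxE subrr dvdz0.
Qed.

(** A common multiple of all sides of all dominos, the large one included, in all directions at
    once. *)
Definition period : nat := (\prod_i \prod_j w j i)%N.

Lemma period_gt0 : (0 < period)%N.
Proof. by rewrite prodn_gt0 // => i; rewrite prodn_gt0. Qed.

Lemma shape_dvd_period a i : (shape a i %| period)%N.
Proof.
rewrite /period (bigD1 i) //= dvdn_mulr //; case: a => [j|//] /=.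
by rewrite (bigD1 j) //= dvdn_mulr.
Qed.

Definition upd (f : 'I_d -> int) i0 x i := if i == i0 then x else f i.

(** For a fixed direction [i0], the admissible thicknesses form a semigroup (stack two slabs)
    containing every [w j i0] (one layer of dominos of type [j]). The bound [C] is the maximum over
    the directions. *)
Lemma tileable_slab_large : (forall i, \big[gcdn/0%N]_(j < k) w j i = 1%N) ->
  exists C : nat, forall (lo hi : 'I_d -> int) i0, C%:Z <= hi i0 - lo i0 ->
  (forall i, i != i0 -> (period %| hi i - lo i)%Z) -> tileable (ibox lo hi).
Proof.
move=> w_gcd.
suff H (i0 : 'I_d) : exists C : nat, forall n, (C <= n)%N ->
    forall lo hi : 'I_d -> int, hi i0 - lo i0 = n%:Z -> (forall i, i != i0 -> (period %| hi i - lo i)%Z) ->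
    tileable (ibox lo hi).
  have [C HC] := choice H; exists (\max_i C i)%N => lo hi i0 le.
  by apply: (HC i0 `|hi i0 - lo i0|%N); have := leq_bigmax (F := C) i0; lia.
apply: (@semigroup_large _ (index_enum 'I_k) (fun j => w j i0)); last exact: w_gcd.
- move=> lo hi e _; suff -> : ibox lo hi = set0 by exact: tileable0.
  by apply/seteqP; split => // v /(_ i0); lia.
- move=> m n Tm Tn lo hi e dv.
  set mid := lo i0 + m%:Z.
  have -> : ibox lo hi = ibox lo (upd hi i0 mid) `|` ibox (upd lo i0 mid) hi.
    apply/seteqP; split => v.
      move=> vb; have [lt|ge] := ltP (v 0 i0) mid; [left|right] => i;
        rewrite /upd; case: eqP => [->|_]; have := vb i; have := vb i0; lia.
    by case=> vb i; have := vb i; have := vb i0; rewrite /upd eqxx /mid;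
      case: eqP => [->|_]; lia.
  apply: tileableU.
  + apply/seteqP; split => // v [v1 v2].
    by have := v1 i0; have := v2 i0; rewrite /upd eqxx; lia.
  + apply: Tm; first by rewrite /upd eqxx /mid; lia.
    by move=> i ne; rewrite /upd (negPf ne) dv.
  + apply: Tn; first by rewrite /upd eqxx /mid; lia.
    by move=> i ne; rewrite /upd (negPf ne) dv.
- move=> j; split=> // lo hi e dv.
  apply: (@tileable_ibox_dvd (Some j)) => i /=.
  have [->|ne] := eqVneq i i0; first by rewrite e.
  apply: dvdz_trans (dv _ ne).
  by have := shape_dvd_period (Some j) i.
Qed.

Definition cube (L : nat) : set vec := ibox (fun=> 0) (fun=> L%:Z).

Definition core (K L : nat) : set vec :=
  ibox (fun=> K%:Z) (fun=> L%:Z - K%:Z).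

(** Losing one [period] in the side leaves room to choose the corner [r] on a foreign grid while
    staying in the cube. *)
Definition frame (L : nat) (r : 'I_d -> int) : set vec :=
  ibox r (fun i => r i + (L%:Z - period%:Z)).

Lemma core_cube K L : core K L `<=` cube L.
Proof. by move=> v vc i; have := vc i; lia. Qed.

Lemma frame_cube L r : (forall i, 0 <= r i < period%:Z) -> frame L r `<=` cube L.
Proof. by move=> rP v vf i; have := vf i; have := rP i; lia. Qed.

Lemma core_frame K L r : (forall i, 0 <= r i < period%:Z) -> (period <= K)%N ->
  core K L `<=` frame L r.
Proof. by move=> rP PK v vf i; have := vf i; have := rP i; lia. Qed.

(* The core is enlarged to the frame one coordinate direction at a time; each
   enlargement adds two slabs whose sides in all other directions are multiples
   of the period. *)
Lemma tileable_frame (C K L : nat) (r : 'I_d -> int) :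
  (forall (lo hi : 'I_d -> int) i0, C%:Z <= hi i0 - lo i0 ->
    (forall i, i != i0 -> (period %| hi i - lo i)%Z) -> tileable (ibox lo hi)) ->
  (C + period <= K)%N -> (period %| K)%N -> (K + K <= L)%N -> (period %| L)%N ->
  (forall i, 0 <= r i < period%:Z) -> tileable (frame L r `\` core K L).
Proof.
move=> slab CK PK KL PL rP.
(* Coordinates below [m] already have the extent of the frame, the others still that of the core. *)
pose lo m (i : 'I_d) := if (i < m)%N then r i else K%:Z.
pose hi m (i : 'I_d) := if (i < m)%N then r i + (L%:Z - period%:Z) else L%:Z - K%:Z.
have -> : frame L r `\` core K L = ibox (lo d) (hi d) `\` core K L.
  congr (_ `\` _); apply/seteqP.
  by split=> v vb i; have := vb i; rewrite /lo /hi ltn_ord.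
have dv m i : (period %| hi m i - lo m i)%Z.
  rewrite /lo /hi; case: ifP => _.
    have -> : r i + (L%:Z - period%:Z) - r i = L%:Z - period%:Z by lia.
    by rewrite rpredB ?dvdzE.
  have -> : L%:Z - K%:Z - K%:Z = L%:Z - (K + K)%N%:Z by lia.
  by rewrite rpredB ?dvdzE ?dvdn_add.
suff H m : (m <= d)%N -> tileable (ibox (lo m) (hi m) `\` core K L) by exact: H.
elim: m => [_|m IH md].
  suff -> : ibox (lo 0%N) (hi 0%N) `\` core K L = set0 by exact: tileable0.
  by apply/seteqP; split => // v [].
set i0 := Ordinal md.
have ltS (i : 'I_d) : (i < m.+1)%N = (i == i0) || (i < m)%N.
  by rewrite ltnS leq_eqVlt.
have coreb : core K L `<=` ibox (lo m) (hi m).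
  by move=> v vc i; have := vc i; have := rP i; rewrite /lo /hi; case: ifP; lia.
have -> : ibox (lo m.+1) (hi m.+1) `\` core K L = (ibox (lo m) (hi m) `\` core K L)
  `|` ibox (upd (lo m) i0 (r i0)) (upd (hi m) i0 K%:Z)
  `|` ibox (upd (lo m) i0 (L%:Z - K%:Z))
           (upd (hi m) i0 (r i0 + (L%:Z - period%:Z))).
  have ri0 := rP i0.
  apply/seteqP; split => v.
    move=> [vb nc]; have := vb i0; rewrite /lo /hi ltS eqxx /= => vi0.
    have [lt|ge] := ltP (v 0 i0) K%:Z.
      left; right => i; rewrite /upd; case: eqP => [->|/eqP ne]; first lia.
      by have := vb i; rewrite /lo /hi ltS (negPf ne).
    have [lt2|ge2] := ltP (v 0 i0) (L%:Z - K%:Z).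
      left; left; split=> // i.
      have [->|ne] := eqVneq i i0; first by rewrite /lo /hi ltnn; lia.
      by have := vb i; rewrite /lo /hi ltS (negPf ne).
    right => i; rewrite /upd; case: eqP => [->|/eqP ne]; first lia.
    by have := vb i; rewrite /lo /hi ltS (negPf ne).
  case=> [[[vb nc]|vb]|vb].
  - split=> // i; have := vb i; rewrite /lo /hi ltS.
    have [->|ne] //= := eqVneq i i0.
    by rewrite ltnn; lia.
  - split=> [i|/(_ i0)]; last first.
      by have := vb i0; rewrite /upd eqxx; lia.
    have := vb i; rewrite /lo /hi ltS /upd.
    have [->|ne] //= := eqVneq i i0.
    by lia.
  - split=> [i|/(_ i0)]; last first.
      by have := vb i0; rewrite /upd eqxx; lia.
    have := vb i; rewrite /lo /hi ltS /upd.
    have [->|ne] //= := eqVneq i i0.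
    by lia.
have ri0 := rP i0.
(* The slabs have thickness [K - r i0] and [K - period + r i0], both at least [C]. *)
apply: tileableU; first 2 [apply: tileableU; last 1 first].
- apply/seteqP; split=> // v [[[vb _]|vb] v3]; have := vb i0; have := v3 i0;
    by rewrite /upd eqxx /lo /hi ?ltnn; lia.
- apply: (slab _ _ i0) => [|i ne]; first by rewrite /upd eqxx; lia.
  by rewrite /upd (negPf ne).
- apply/seteqP; split=> // v [[vb _] v2]; have := vb i0; have := v2 i0.
  by rewrite /upd eqxx /lo /hi ?ltnn; lia.
- exact: IH (ltnW md).
- apply: (slab _ _ i0) => [|i ne]; first by rewrite /upd eqxx; lia.
  by rewrite /upd (negPf ne).
Qed.

(** * Merging the tilings of nested cubes *)

Lemma dominoset_shift a c b m : dominoset a (c + b) m <-> dominoset a c (m - b).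
Proof.
split=> cm i; have := cm i; rewrite !mxE;
  by move: (c 0 i) (b 0 i) (m 0 i) => x y z; lia.
Qed.

Lemma grid_corner_eq a b n m :
  dominoset a (grid_corner a b n) m -> grid_corner a b m = grid_corner a b n.
Proof.
move=> mn; apply/rowP => i; have := mn i; rewrite !mxE.
have := shape_gt0 a i.
move: (shape a i) (n 0 i) (b 0 i) (m 0 i) => s x z t s0 h.
have -> : ((t - z) %% s)%Z = t - (x - ((x - z) %% s)%Z).
  have -> : t - z = ((x - z) %/ s)%Z * s + (t - (x - ((x - z) %% s)%Z)).
    by have := divz_eq (x - z) s; lia.
  by rewrite modzMDl modz_small //; lia.
by lia.
Qed.

(* [loc n = Some (L, v)] means that [n] lies in a cube of side [L], at position
   [v] relative to its lower corner [n - v]. *)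
Definition cubes_consistent (loc : vec -> option (nat * vec)) :=
  forall n L v, loc n = Some (L, v) ->
    cube L v /\ forall u, cube L u -> loc (n - v + u) = Some (L, u).

Lemma consistentE loc n L v m : cubes_consistent loc -> loc n = Some (L, v) ->
  cube L (m - (n - v)) -> loc m = Some (L, m - (n - v)).
Proof.
by move=> cl /cl [_ e] /e; rewrite addrC subrK.
Qed.

(* The cube of side [L] lies in the core of the cube of side [L'], when its
   lower corner is at position [t] of the latter. *)
Definition nested (K L L' : nat) (t : vec) : bool :=
  [forall i, (K%:Z <= t 0 i) && (t 0 i + L%:Z <= L'%:Z - K%:Z)].

(** The offset for which [t + alignment t] is divisible by [period], so that the frame of an inner
    cube at position [t] sits on the grid of the outer cube. *)
Definition alignment (t : vec) (i : 'I_d) : int := (- t 0%R i %% period)%Z.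

Lemma alignment_lt t i : 0 <= alignment t i < period%:Z.
Proof. by have := period_gt0; rewrite /alignment; lia. Qed.

(** [q] and [q'] locate a point in the old and new cubes. In a nested old cube the core keeps its
    symbol [a] and the rest of the frame is filled; all other points of new cubes follow the new
    grid. Outside new cubes the value is a dummy. *)
Definition refine K (fill : nat -> ('I_d -> int) -> vec -> domino_alphabet w)
    (q q' : option (nat * vec)) (a : domino_alphabet w) : domino_alphabet w :=
  match q, q' with
  | Some (L, v), Some (L', v') =>
    if nested K L L' (v' - v) && (v \in core K L) then a
    else if nested K L L' (v' - v) && (v \in frame L (alignment (v' - v)))
    then fill L (alignment (v' - v)) v else cell None v'
  | None, Some (L', v') => cell None v'
  | _, None => cell None 0
  end.

Definition core_tiled K (loc : vec -> option (nat * vec)) y :=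
  forall n L v, loc n = Some (L, v) -> core K L v ->
    covered [set m | core K L (m - (n - v))] y n.

(** Old cores, frames minus cores, and what remains of the new core are each a union of dominos: by
    hypothesis on [y], by [fillP], and because frames and new core are both aligned with the new
    grid. *)
Lemma refine_core_tiled K fill loc loc' y :
  (period <= K)%N -> (period %| K)%N ->
  (forall L r, (K + K <= L)%N -> (period %| L)%N ->
    (forall i, 0 <= r i < period%:Z) ->
    forall n, (frame L r `\` core K L) n ->
      covered (frame L r `\` core K L) (fill L r) n) ->
  cubes_consistent loc -> cubes_consistent loc' ->
  (forall n L v, loc n = Some (L, v) -> (K + K <= L)%N /\ (period %| L)%N) ->
  (forall n L v, loc' n = Some (L, v) -> (period %| L)%N) ->
  core_tiled K loc y ->
  core_tiled K loc' (fun n => refine K fill (loc n) (loc' n) (y n)).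
Proof.
move=> PK KP fillP cl cl' locL loc'L IH n L' v' e' cv'.
have L'P := loc'L _ _ _ e'.
have E' m : core K L' (m - (n - v')) -> loc' m = Some (L', m - (n - v')).
  by move=> /core_cube; exact: consistentE.
have tE m L v x : loc m = Some (L, v) ->
    x - (n - v') - (x - (m - v)) = m - (n - v') - v.
  by move=> _; apply/rowP => i; rewrite !mxE; lia.
have nestP L m v x : loc m = Some (L, v) -> nested K L L' (m - (n - v') - v) ->
    cube L (x - (m - v)) -> core K L' (x - (n - v')).
  move=> _ /forallP ne xc i; have := ne i; have := xc i; rewrite !mxE.
  by lia.
have nE : n - (n - v') = v' by rewrite subKr.
(* Outside all nested frames, the grid tile of [n] stays in the new core and meets no nested
   frame. *)
have grid : (forall L v, loc n = Some (L, v) -> nested K L L' (v' - v) ->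
      ~ frame L (alignment (v' - v)) v) ->
    covered [set m | core K L' (m - (n - v'))]
      (fun m => refine K fill (loc m) (loc' m) (y m)) n.
  move=> nofr.
  have gc : dominoset None (grid_corner None (n - v') n) `<=`
      [set m | core K L' (m - (n - v'))].
    move=> m mg.
    have /= h : ibox (fun i => (n - v') 0 i + K%:Z)
        (fun i => (n - v') 0 i + (L'%:Z - K%:Z)) m.
      apply: grid_corner_sub_ibox mg => i; last first.
        have := cv' i; rewrite mxE [(- v') 0 i]mxE.
        by move: (n 0 i) (v' 0 i) => s t; clear; lia.
      have sP : (shape None i %| period%:Z)%Z by exact: shape_dvd_period.
      split; first by rewrite addrAC subrr add0r (dvdz_trans sP).
      rewrite [X in (_ %| X)%Z](_ : _ = L'%:Z - (K + K)%N%:Z); last by lia.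
      by rewrite (dvdz_trans sP) // rpredB ?dvdzE ?dvdn_add.
    move=> i; have := h i; rewrite [(m - _) 0 i]mxE [(- (n - v')) 0 i]mxE.
    by move: (m 0 i) ((n - v') 0 i) => s t; clear; lia.
  apply: (@covered_grid None (n - v')) => [//|m mg].
  rewrite (E' _ (gc _ mg)) /refine.
  case em : (loc m) => [[L v]|//].
  have [L2 LP] := locL _ _ _ em.
  set t := m - (n - v') - v; have rP := alignment_lt t.
  suff nf : nested K L L' t -> ~ frame L (alignment t) v.
    case: ifPn => [/andP[/nf h]|_]; first by rewrite inE => /(core_frame rP PK).
    by case: ifPn => // /andP[/nf h]; rewrite inE.
  move=> ne vf.
  (* An aligned frame meeting the tile at [m] contains the whole tile, hence also [n]. *)
  have nf : frame L (alignment t) (n - (m - v)).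
    have h : ibox (fun i => (m - v) 0 i + alignment t i)
        (fun i => (m - v) 0 i + (alignment t i + (L%:Z - period%:Z))) n.
      apply: (@grid_corner_sub_ibox None (n - v') m).
      - move=> i; have sP : (shape None i %| period%:Z)%Z by exact: shape_dvd_period.
        split; last first.
          rewrite [X in (_ %| X)%Z](_ : _ = L%:Z - period%:Z); last by lia.
          by rewrite (dvdz_trans sP) // rpredB ?dvdzE.
        apply: dvdz_trans sP _; rewrite /alignment.
        have -> : (m - v) 0 i = (n - v') 0 i + t 0 i.
          by rewrite /t !mxE; move: (m 0 i) (n 0 i) (v 0 i) (v' 0 i); clear; lia.
        move: ((n - v') 0 i) (t 0 i) => x s.
        have -> : x + s + (- s %% period)%Z - x = - ((- s %/ period)%Z * period).
          have := divz_eq (- s) period.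
          by move: (- s %/ period)%Z (- s %% period)%Z => q r; clear; lia.
        by rewrite rpredN dvdz_mull.
      - move=> i; have := vf i; rewrite [(m - v) 0 i]mxE [(- v) 0 i]mxE.
        by move: (m 0 i) (v 0 i) => s x; clear; lia.
      - by rewrite (grid_corner_eq mg); exact: grid_corner_mem.
    move=> i; have := h i; rewrite [(n - _) 0 i]mxE [(- (m - v)) 0 i]mxE.
    by move: (n 0 i) ((m - v) 0 i) => s x; clear; lia.
  apply: (nofr L (n - (m - v))).
  - exact: consistentE em (frame_cube rP nf).
  - suff <- : t = v' - (n - (m - v)) by [].
    by apply/rowP => i; rewrite !mxE; move: (m 0 i) (n 0 i) (v 0 i) (v' 0 i);
      clear; lia.
  - suff <- : t = v' - (n - (m - v)) by [].
    by apply/rowP => i; rewrite !mxE; move: (m 0 i) (n 0 i) (v 0 i) (v' 0 i);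
      clear; lia.
case e : (loc n) => [[L v]|]; last by apply: grid => L v; rewrite e.
have [L2 LP] := locL _ _ _ e.
have nb : n - (n - v) = v by rewrite subKr.
have [/andP [ne]|nc] := boolP (nested K L L' (v' - v) && (v \in core K L)).
  rewrite inE => vc.
  apply: covered_sub (IH _ _ _ e vc) => m.
    by move=> /core_cube; apply: nestP e _; rewrite nE.
  rewrite inE => /= mc.
  have := E' m (nestP _ _ _ _ e _ (core_cube mc)); rewrite nE => /(_ ne) ->.
  rewrite (consistentE cl e (core_cube mc)) /refine.
  by rewrite (tE _ _ _ _ e) nE ne /= mem_set.
have [/andP [ne]|nf] :=
    boolP (nested K L L' (v' - v) && (v \in frame L (alignment (v' - v)))).
  rewrite inE => vf; have rP := alignment_lt (v' - v).
  move: nc; rewrite ne /= => /negP; rewrite inE => nc.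
  have [a [c [cv cS yc]]] := fillP _ _ L2 LP rP v (conj vf nc).
  exists a, (c + (n - v)); split.
  - by apply/dominoset_shift; rewrite nb.
  - move=> m /dominoset_shift/cS [/(frame_cube rP) mc _].
    by apply: nestP e _ mc; rewrite nE.
  - move=> m /dominoset_shift cm; have [mf mc] := cS _ cm.
    have mcu := frame_cube rP mf.
    have := E' m (nestP _ _ _ _ e _ mcu); rewrite nE => /(_ ne) ->.
    rewrite (consistentE cl e mcu) /refine (tE _ _ _ _ e) nE ne /=.
    rewrite (memNset mc) (mem_set mf) /= yc //; congr cell.
    by rewrite -addrA -opprD [n - v + c]addrC.
apply: grid => L1 v1; rewrite e => -[<- <-] ne vf.
by move: nf; rewrite ne mem_set.
Qed.

End Geometry.

(** * Partitions of orbits into cubes *)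

Section MeasurablePartition.
Context (disp : measure_display) (X : measurableType disp).

Lemma measurable_bigcup_count (I : countType) (D : set I) (F : I -> set X) :
  (forall i, D i -> measurable (F i)) -> measurable (\bigcup_(i in D) F i).
Proof.
move=> mF; rewrite bigcup_mkcond; apply: countable_bigcupT_measurable => // i.
by case: ifPn => //; rewrite inE; exact: mF.
Qed.

Lemma measurable_bigcap_count (I : countType) (D : set I) (F : I -> set X) :
  (forall i, D i -> measurable (F i)) -> measurable (\bigcap_(i in D) F i).
Proof.
move=> mF; rewrite -[X in measurable X]setCK setC_bigcap; apply: measurableC.
by apply: measurable_bigcup_count => i /mF; exact: measurableC.
Qed.

Lemma measurable_partition_count (S : countType) (f : X -> S) :
  (forall s, measurable [set x | f x = s]) -> measurable_partition f.
Proof.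
move=> mf B; have -> : f @^-1` B = \bigcup_(s in B) [set x | f x = s].
  by apply/seteqP; split => [x Bx|x [s Bs /= xs]]; [exists (f x)|rewrite /= xs].
exact: measurable_bigcup_count.
Qed.

Lemma measurable_partition_comp (S S' : Type) (f : X -> S) (g : S -> S') :
  measurable_partition f -> measurable_partition (g \o f).
Proof. by move=> mf B; rewrite comp_preimage; exact: mf. Qed.

Lemma measurable_partition_pair (S S' : countType) (f : X -> S) (g : X -> S') :
  measurable_partition f -> measurable_partition g ->
  measurable_partition (fun x => (f x, g x)).
Proof.
move=> mf mg; apply: measurable_partition_count => -[s s'].
have -> : [set x | (f x, g x) = (s, s')] =
    f @^-1` [set s] `&` g @^-1` [set s'].
  by apply/seteqP; split => x /= [-> ->].
by apply: measurableI; [exact: mf|exact: mg].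
Qed.

Lemma measurable_partition_cst (S : Type) (s : S) :
  measurable_partition (fun _ : X => s).
Proof.
move=> B; have [Bs|nBs] := pselect (B s).
  by rewrite preimage_cst mem_set.
by rewrite preimage_cst memNset.
Qed.

End MeasurablePartition.

(** * Real-valued probabilities *)

Section Probability.
Context (disp : measure_display) (X : measurableType disp) (R : realType).
Variable mu : probability X R.

Definition pr (A : set X) : R := fine (mu A).

Lemma prE A : measurable A -> mu A = (pr A)%:E.
Proof. by move=> mA; rewrite /pr fineK //; exact: fin_num_measure. Qed.

Lemma pr_le1 A : measurable A -> pr A <= 1.
Proof. by move=> mA; rewrite -lee_fin -prE //; exact: probability_le1. Qed.

Lemma le_pr A B : measurable A -> measurable B -> A `<=` B -> pr A <= pr B.
Proof. by move=> mA mB AB; rewrite -lee_fin -!prE // le_measure ?inE. Qed.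

Lemma prU A B : measurable A -> measurable B -> A `&` B = set0 ->
  pr (A `|` B) = pr A + pr B.
Proof.
move=> mA mB AB; apply/EFin_inj; rewrite EFinD -!prE ?measureU //.
exact: measurableU.
Qed.

Lemma prU_le A B : measurable A -> measurable B -> pr (A `|` B) <= pr A + pr B.
Proof.
move=> mA mB; rewrite -lee_fin EFinD -!prE //; last exact: measurableU.
exact: measureU2.
Qed.

Lemma pr_bigcup_le (I : choiceType) (r : seq I) (F : I -> set X) :
  (forall i, measurable (F i)) ->
  pr (\bigcup_(i in [set` r]) F i) <= \sum_(i <- r) pr (F i).
Proof.
move=> mF; rewrite bigcup_seq; elim: r => [|i r IH].
  by rewrite !big_nil /pr measure0.
rewrite !big_cons (le_trans (prU_le _ _)) ?lerD2l //.
exact: bigsetU_measurable.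
Qed.

Lemma pr_bigcup_disjoint (I : choiceType) (r : seq I) (F : I -> set X) :
  uniq r -> (forall i, measurable (F i)) ->
  {in r &, forall i j, i != j -> F i `&` F j = set0} ->
  pr (\bigcup_(i in [set` r]) F i) = \sum_(i <- r) pr (F i).
Proof.
move=> ur mF dF; rewrite bigcup_seq; elim: r ur dF => [|i r IH] /=.
  by rewrite !big_nil /pr measure0.
move=> /andP[ir ur] dF; rewrite !big_cons prU ?IH //.
- by move=> j l jr lr; apply: dF; rewrite inE ?jr ?lr orbT.
- exact: bigsetU_measurable.
rewrite -bigcup_seq setI_bigcupr bigcup0 // => j /= jr.
apply: dF; rewrite ?inE ?eqxx ?jr ?orbT //.
by apply: contraNneq ir => ->.
Qed.

End Probability.

Lemma avoid_interval (R : realType) (a : R) (s : seq R) : a \notin s ->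
  exists q1 q2 : rat, ratr q1 < a < ratr q2 /\
    forall b, b \in s -> ~~ (ratr q1 < b < ratr q2).
Proof.
move=> an; have [e e0 He] : exists2 e, 0 < e & forall b, b \in s -> e <= `|b - a|.
  elim: s an => [_|b s IH]; first by exists 1.
  rewrite inE negb_or => /andP[ab /IH[e e0 He]].
  exists (Num.min e `|b - a|).
    by rewrite lt_min e0 normr_gt0 subr_eq0 eq_sym.
  by move=> c; rewrite inE ge_min => /orP[/eqP ->|/He ->]; rewrite ?lexx ?orbT.
have [q1] : exists q : rat, ratr q \in `]a - e, a[%R by apply: rat_in_itvoo; lra.
have [q2] : exists q : rat, ratr q \in `]a, a + e[%R by apply: rat_in_itvoo; lra.
rewrite !in_itv /= => /andP[q2l q2r] /andP[q1l q1r].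
exists q1, q2; split=> [|b /He]; first by rewrite q1r.
by apply: contraTN => /andP[b1 b2]; rewrite -ltNge ltr_norml; lra.
Qed.

(** * Separated sets in a free action, and systems of cubes *)

Section Action.
Context (disp : measure_display) (X : measurableType disp) (R : realType).
Variables (mu : probability X R) (d : nat) (T : 'rV[int]_d -> X -> X).
Hypothesis hT : measure_preserving_action mu T.

Local Notation vec := 'rV[int]_d.
Local Notation pr := (pr mu).

Lemma act0 x : T 0 x = x. Proof. by case: hT. Qed.

Lemma actD u v x : T (u + v) x = T u (T v x). Proof. by case: hT. Qed.

Lemma actK v : cancel (T v) (T (- v)).
Proof. by move=> x; rewrite -actD addNr act0. Qed.

Lemma measurable_act v A : measurable A -> measurable (T v @^-1` A).
Proof.
by move=> mA; rewrite -[X in measurable X]setTI; case: hT => _ _ mT _; exact: mT.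
Qed.

Lemma pr_act v A : measurable A -> pr (T v @^-1` A) = pr A.
Proof. by move=> mA; congr fine; case: hT => _ _ _; exact. Qed.

(** The group is countable and each translate of a null set is null. *)
Lemma ae_orbit (P : X -> Prop) : {ae mu, forall x, P x} ->
  {ae mu, forall x, forall v, P (T v x)}.
Proof.
move=> [N [mN N0 PN]].
have : {ae mu, forall x, forall n,
    if unpickle n is Some v then P (T v x) else True}.
  apply: ae_foralln => n; case: (unpickle n) => [v|]; last exact: nearW.
  exists (T v @^-1` N); split; first exact: measurable_act.
    by rewrite -N0; case: hT => _ _ _; exact.
  by move=> x /= nP; exact: PN.
by apply: filterS => x Px v; have := Px (pickle v); rewrite pickleK.
Qed.

Definition small (N : nat) (v : vec) : Prop := forall i, `|v 0 i| < N%:Z.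

Lemma smallN N v : small N v -> small N (- v).
Proof. by move=> sv i; rewrite mxE normrN. Qed.

Lemma small_cubeB N u v : cube N u -> cube N v -> small N (u - v).
Proof.
move=> cu cv i; have := cu i; have := cv i; rewrite !mxE.
by move: (u 0 i) (v 0 i) => s t; lia.
Qed.

Definition box_enum (a : int) (N : nat) : seq vec :=
  [seq \row_i (a + (f i)%:Z) | f : {ffun 'I_d -> 'I_N}].

Lemma size_box_enum a N : size (box_enum a N) = (N ^ d)%N.
Proof. by rewrite size_map -cardE card_ffun !card_ord. Qed.

Lemma box_enumP a N (v : vec) :
  reflect (forall i, a <= v 0 i < a + N%:Z) (v \in box_enum a N).
Proof.
apply: (iffP mapP) => [[f _ ->] i|vb].
  by rewrite mxE; have := ltn_ord (f i); move: (nat_of_ord (f i)) => t; lia.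
have lt (i : 'I_d) : (`|v 0%R i - a| < N)%N by have := vb i; lia.
exists [ffun i => Ordinal (lt i)]; rewrite ?mem_enum //.
by apply/rowP => i; rewrite mxE ffunE /=; have := vb i; lia.
Qed.

Lemma uniq_box_enum a N : uniq (box_enum a N).
Proof.
rewrite map_inj_uniq ?enum_uniq // => f g /rowP fg; apply/ffunP => i.
by apply/val_inj; have := fg i; rewrite !mxE /=; lia.
Qed.

(* An injective [f] separates the points of a free orbit, so a rational interval
   around [f x] avoids [f (T v x)] for the finitely many small [v <> 0]. *)
Lemma separated_cover N : standard_probability mu -> free_action mu T ->
  exists C : nat -> set X, [/\ forall n, measurable (C n),
    forall n x v, C n x -> small N v -> v != 0 -> ~ C n (T v x) &
    {ae mu, forall x, exists n, C n x}].
Proof.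
move=> [X0 [f [mX0 X01 finj _]]] hfree.
pose I (q : rat * rat) : set R := `]ratr q.1, ratr q.2[%classic.
pose F q : set X := f @^-1` I q `&`
  \bigcap_(v in [set v | small N v /\ v != 0]) (T v @^-1` (~` (f @^-1` I q))).
have mf q : measurable (f @^-1` I q).
  by apply: measurable_funPTI; exact: measurable_itv.
have mF q : measurable (F q).
  apply: measurableI => //; apply: measurable_bigcap_count => v _.
  by apply: measurable_act; apply: measurableC.
exists (fun n => if unpickle n is Some q then F q else set0); split.
- by move=> n; case: unpickle.
- move=> n x v; case: unpickle => // q [_ /(_ v) Fx] sv v0 [Fv _].
  exact: Fx Fv.
(* Injectivity of [f] is known on [X0] only, so the orbit has to stay there. *)
have : {ae mu, forall x, forall v, X0 (T v x)}.
  apply: (@ae_orbit X0); exists (~` X0); split=> //; first exact: measurableC.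
  by rewrite probability_setC // X01 subee.
move: hfree; apply: filterS2 => x xfree xX0.
have [] := @avoid_interval R (f x) [seq f (T v x) | v <- box_enum (- N%:Z) (N + N) & v != 0].
  apply/mapP => -[v]; rewrite mem_filter => /andP[v0 _] fE.
  have := xfree v v0; rewrite -(finj x (T v x)) ?eqxx ?inE //.
  by have := xX0 0; rewrite act0.
move=> q1 [q2 [q12 Hq]]; exists (pickle (q1, q2)); rewrite pickleK.
split; first by rewrite /I /= in_itv.
move=> v [sv v0]; rewrite /I /= in_itv /=; apply/negP; apply: Hq.
apply: map_f; rewrite mem_filter v0; apply/box_enumP => i.
by have := sv i; lia.
Qed.

(** Greedy choice: run through the sets [C n], adding the points of [D] not close to an earlier
    choice. Points of one [C n] never conflict, and almost every point gets its turn. *)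
Lemma maximal_separated N (D : set X) : (0 < N)%N -> measurable D ->
  standard_probability mu -> free_action mu T ->
  exists A : set X, [/\ measurable A, A `<=` D,
    forall x v, A x -> small N v -> A (T v x) -> v = 0 &
    {ae mu, forall x, D x -> exists2 v, small N v & A (T v x)}].
Proof.
move=> N0 mD hst hfree; have [C [mC sepC covC]] := separated_cover N hst hfree.
pose step n (A : set X) : set X := A `|` (C n `&` D `&`
  \bigcap_(v in small N) (T v @^-1` (~` A))).
pose A := fix A n := if n is m.+1 then step m (A m) else set0.
have mA n : measurable (A n).
  elim: n => [|n IH]; first exact: measurable0.
  rewrite /= /step; apply: measurableU => //; apply: measurableI.
    exact: measurableI.
  apply: measurable_bigcap_count => v _.
  by apply: measurable_act; apply: measurableC.
have homoA m n : (m <= n)%N -> A m `<=` A n.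
  by move/subnK <-; elim: (n - m)%N => [//|t IH] x /IH; rewrite addSn; left.
have sepA n x v : A n x -> small N v -> A n (T v x) -> v = 0.
  elim: n x v => [//|n IH] x v /= [Ax|[[Cx Dx] nx]] sv [Av|[[Cv Dv] nv]].
  - exact: IH Ax sv Av.
  - by have := nv _ (smallN sv); rewrite /= actK.
  - by have := nx _ sv.
  - by apply/eqP/negPn/negP => v0; exact: sepC Cx sv v0 Cv.
exists (\bigcup_n A n); split.
- exact: bigcup_measurable.
- by move=> x [n _]; elim: n => [//|n IH] /= [/IH //|[[]]].
- move=> x v [m _ Am] sv [n _ An].
  apply: (sepA (maxn m n) x v _ sv).
    exact: homoA (leq_maxl m n) _ Am.
  exact: homoA (leq_maxr m n) _ An.
move: covC; apply: filterS => x [n Cx] Dx.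
have [[v [sv Av]]|nA] := pselect (exists v, small N v /\ A n (T v x)).
  by exists v => //; exists n.
exists 0; first by move=> i; rewrite mxE normr0.
exists n.+1 => //; rewrite act0; right; split=> // v sv Av.
by apply: nA; exists v.
Qed.

(* [loc x = Some (L, v)] means that [x] lies in a cube of side [L] of its orbit,
   whose lower corner is [T (- v) x]. *)
Definition cube_system (P N M : nat) (loc : X -> option (nat * vec)) : Prop :=
  [/\ measurable_partition loc,
    forall x L v, loc x = Some (L, v) ->
      cube L v /\ forall u, cube L u -> loc (T (u - v) x) = Some (L, u) &
    forall x L v, loc x = Some (L, v) -> [/\ (N <= L)%N, (L <= M)%N & (P %| L)%N]].

Definition uncovered (loc : X -> option (nat * vec)) : set X :=
  [set x | loc x = None].

(** Distance, counted from 0, to the upper ([b] true) or lower face of the cube in direction [i]. *)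
Definition depth (b : bool) (i : 'I_d) (L : nat) (v : vec) : int :=
  if b then L%:Z - 1 - v 0 i else v 0 i.

Definition level (loc : X -> option (nat * vec)) b i (s : int) : set X :=
  [set x | exists L v, loc x = Some (L, v) /\ depth b i L v = s].

Lemma measurable_level loc b i s :
  measurable_partition loc -> measurable (level loc b i s).
Proof.
by move=> /(_ [set q | exists L v, q = Some (L, v) /\ depth b i L v = s]).
Qed.

(** A translation carries level [s] into level 0, and others carry level 0 into each of the levels
    below [N], as all cubes have side at least [N]. These [N] levels are disjoint. *)
Lemma pr_level P N M loc b i (s : nat) : (0 < N)%N -> cube_system P N M loc ->
  pr (level loc b i s) <= N%:R^-1.
Proof.
move=> N0 [mloc cl sz].
have mL t : measurable (level loc b i t) by exact: measurable_level.
pose e (t : int) : vec := \row_j (if j == i then (if b then - t else t) else 0).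
have shift (t t' : int) : (forall x L v, loc x = Some (L, v) ->
      depth b i L v = t -> 0 <= t' < L%:Z) ->
    level loc b i t `<=` T (e (t' - t)) @^-1` level loc b i t'.
  move=> tt' x [L [v [lx dv]]]; have [cv {}cl] := cl _ _ _ lx.
  have t'L := tt' _ _ _ lx dv.
  exists L, (v + e (t' - t)); split.
    rewrite -[X in T X](addKr v) [- v + _]addrC; apply: cl => j; rewrite !mxE.
    have := cv j; have := cv i; move: dv; rewrite /depth.
    by case: eqP => [->|_]; case: (b) => /=; move: (v 0 i) => z; lia.
  move: dv; rewrite /depth !mxE eqxx.
  by case: (b) => /=; move: (v 0 i) => z; lia.
have ps0 : pr (level loc b i s) <= pr (level loc b i 0).
  rewrite -(pr_act (e (0 - s%:Z)) (mL 0)); apply: le_pr => //.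
    exact: measurable_act.
  apply: shift => x L v lx dv; have := cl _ _ _ lx; have [NL _ _] := sz _ _ _ lx.
  by move=> _; lia.
apply: le_trans ps0 _.
have p0t (t : 'I_N) : pr (level loc b i 0) <= pr (level loc b i t).
  rewrite -(pr_act (e (t%:Z - 0)) (mL t)); apply: le_pr => //.
    exact: measurable_act.
  apply: shift => x L v lx dv; have [NL _ _] := sz _ _ _ lx.
  by have := ltn_ord t; lia.
have : \sum_(t <- enum 'I_N) pr (level loc b i t) <= 1.
  rewrite -pr_bigcup_disjoint ?enum_uniq //.
    by apply: pr_le1; rewrite bigcup_seq; exact: bigsetU_measurable.
  move=> t t' _ _ tt'; apply/seteqP; split => // x [[L [v [lx dv]]] [L' [v' [lx' dv']]]].
  move: tt'; rewrite lx in lx'; case: lx' dv' => <- <-; rewrite dv => -[tt'].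
  by rewrite -val_eqE /= tt' eqxx.
rewrite big_enum /= => le1; rewrite -div1r ler_pdivlMr ?ltr0n // mulrC.
apply: le_trans le1; rewrite -[N in N%:R]card_ord -sumr_const mulr_suml.
by apply: ler_sum => t _; rewrite mul1r.
Qed.

Definition deep (m : nat) (q : option (nat * vec)) : Prop :=
  if q is Some (L, v) then core m L v else False.

(** A covered point outside the core lies at depth less than [m] from one of the [2 * d] faces,
    hence in one of [2 * d * m] levels. *)
Lemma pr_not_deep P N M loc m : (0 < N)%N -> cube_system P N M loc ->
  pr [set x | ~ deep m (loc x)] <= pr (uncovered loc) + (2 * d * m)%:R / N%:R.
Proof.
move=> N0 cs; have [mloc cl sz] := cs.
have mL b i s : measurable (level loc b i s) by exact: measurable_level.
pose F (z : bool * 'I_d * 'I_m) := level loc z.1.1 z.1.2 z.2.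
pose r := enum {: bool * 'I_d * 'I_m}.
have mU : measurable (\bigcup_(z in [set` r]) F z).
  by rewrite bigcup_seq; apply: bigsetU_measurable => z _; exact: mL.
have mE : measurable (uncovered loc) by exact: (mloc [set None]).
apply: le_trans (_ : pr (uncovered loc `|` \bigcup_(z in [set` r]) F z) <= _).
  apply: le_pr; [exact: (mloc [set q | ~ deep m q])|exact: measurableU|].
  move=> x /=; case lx : (loc x) => [[L v]|] /=; last by left.
  move=> ncore; right.
  have [i /negP ni] : exists i, ~ (m%:Z <= v 0 i < L%:Z - m%:Z).
    by apply/existsNP.
  have [cv _] := cl _ _ _ lx; have := cv i => /= cvi.
  have [lt|ge] := ltP (v 0 i) m%:Z.
    have lm : (`|v 0%R i| < m)%N by lia.
    exists (false, i, Ordinal lm); first by rewrite /= mem_enum.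
    by exists L, v; split=> //=; rewrite /depth; lia.
  have lm : (`|(L%:Z - 1 - v 0 i)%R| < m)%N by lia.
  exists (true, i, Ordinal lm); first by rewrite /= mem_enum.
  by exists L, v; split=> //=; rewrite /depth; lia.
apply: le_trans (prU_le _ mE mU) _; rewrite lerD2l.
apply: le_trans (pr_bigcup_le _ _ (fun z => mL _ _ _)) _.
apply: le_trans (_ : \sum_(z <- r) N%:R^-1 <= _).
  by apply: ler_sum => z _; exact: pr_level cs.
rewrite big_const_seq count_predT iter_addr_0 /r -cardE !card_prod card_bool !card_ord.
by rewrite mulr_natl.
Qed.

Lemma cube_box_enum N v : cube N v <-> v \in box_enum 0 N.
Proof.
by split=> [cv|/box_enumP cv]; [apply/box_enumP => i|move=> i];
  have := cv i; rewrite add0r.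
Qed.

(* The new cubes, of side [N], have corners in a maximal [N]-separated subset [A]
   of the set of [x] whose cube avoids the old ones.  By maximality a point left
   uncovered is within distance [N] of [A], or just below an old cube, i.e. in
   the translate by at most [N] of a lower level of depth less than [N]. *)
Lemma cube_system_refine P N N' M loc : standard_probability mu ->
  free_action mu T -> (0 < N)%N -> (N <= N')%N -> (P %| N)%N ->
  cube_system P N' M loc ->
  exists loc', cube_system P N (maxn M N) loc' /\
    pr (uncovered loc') * (1 + 2 ^+ d) <=
      pr (uncovered loc) * 2 ^+ d + (N ^ d * (d * N))%:R / N'%:R.
Proof.
move=> hst hfree N0 NN' PN cs; have [mloc cl sz] := cs.
pose D : set X := \bigcap_(v in cube N) (T v @^-1` uncovered loc).
have mE : measurable (uncovered loc) by exact: (mloc [set None]).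
have mD : measurable D.
  by apply: measurable_bigcap_count => v _; exact: measurable_act.
have [A [mA AD sepA covA]] := maximal_separated N0 mD hst hfree.
pose inA x := exists v, cube N v /\ A (T (- v) x).
pose loc' x := if loc x is Some q then Some q else
  if pselect (inA x) is left h then Some (N, sval (cid h)) else None.
have uniqA x v v' : cube N v -> cube N v' -> A (T (- v) x) -> A (T (- v') x) ->
    v = v'.
  move=> cv cv' Av Av'; apply/eqP; rewrite -subr_eq0; apply/eqP.
  apply: (sepA (T (- v) x)) => //; first exact: small_cubeB.
  by rewrite -actD addrC addrA addNr add0r.
have loc'A x v : cube N v -> A (T (- v) x) -> loc' x = Some (N, v) /\ loc x = None.
  move=> cv Av; have lx : loc x = None.
    have := AD _ Av _ cv; rewrite /uncovered /= -actD subrr act0.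
    by [].
  split=> //; rewrite /loc' lx; case: pselect => [h|[]]; last by exists v.
  by case: cid => v' [cv' Av'] /=; rewrite (uniqA x v' v).
have loc'E x : [\/ exists2 q, loc x = Some q & loc' x = Some q,
    exists v, [/\ cube N v, A (T (- v) x), loc x = None & loc' x = Some (N, v)] |
    [/\ ~ inA x, loc x = None & loc' x = None]].
  case lx : (loc x) => [q|].
    by constructor 1; exists q; rewrite // /loc' lx.
  have [[v [cv Av]]|nA] := pselect (inA x).
    by constructor 2; exists v; have [] := loc'A _ _ cv Av.
  by constructor 3; split=> //; rewrite /loc' lx; case: pselect.
have cs' : cube_system P N (maxn M N) loc'.
  split.
  - apply: measurable_partition_count => -[[L v]|]; last first.
      have -> : [set x | loc' x = None] =
          uncovered loc `&` \bigcap_(v in cube N) (T (- v) @^-1` (~` A)).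
        apply/seteqP; split => x /=.
          case: (loc'E x) => [[q _ ->]//|[v [_ _ _ ->]]//|[nA lx _] _].
          by split=> // v cv Av; apply: nA; exists v.
        move=> [lx nA]; case: (loc'E x) => [[q]|[v [cv /(nA _ cv)]]//|[]//].
        by rewrite lx.
      apply: measurableI => //; apply: measurable_bigcap_count => v _.
      by apply: measurable_act; exact: measurableC.
    have -> : [set x | loc' x = Some (L, v)] = (loc @^-1` [set Some (L, v)]) `|`
        [set x | [/\ L = N, cube N v & A (T (- v) x)]].
      apply/seteqP; split => x /=.
        case: (loc'E x) => [[q -> ->]|[u [cu Au _ ->]]|[_ _ ->]//]; first by left.
        by case=> <- <-; right.
      case=> [lx|[-> cv /(loc'A _ _ cv)[]]//].
      by rewrite /loc' lx.
    apply: measurableU; first exact: mloc.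
    have [[-> cv]|nLv] := pselect (L = N /\ cube N v); last first.
      rewrite (_ : [set _ | _] = set0) //; apply/seteqP; split => // x [e cv _].
      by apply: nLv; split=> //; rewrite e.
    rewrite (_ : [set _ | _] = T (- v) @^-1` A); first exact: measurable_act.
    by apply/seteqP; split => x //= [].
  - move=> x L v; case: (loc'E x) => [[q lx ->]|[u [cu Au _ ->]]|[_ _ ->]//].
      case=> qE; rewrite qE in lx; have [cv {}cl] := cl _ _ _ lx.
      by split=> // u /cl lu; rewrite /loc' lu.
    case=> <- <-; split=> // u' cu'.
    have [] := @loc'A (T (u' - u) x) u' => //.
    by rewrite -actD addrA addNr add0r.
  - move=> x L v; case: (loc'E x) => [[q lx ->]|[u [cu Au _ ->]]|[_ _ ->]//].
      case=> qE; rewrite qE in lx; have [NL LM PL] := sz _ _ _ lx.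
      by split=> //; [exact: leq_trans NL|rewrite leq_max LM].
    by case=> <- _; rewrite leq_maxr.
exists loc'; split=> //.
have [mloc' _ _] := cs'.
have mE' : measurable (uncovered loc') by exact: (mloc' [set None]).
have mTA v : measurable (T v @^-1` A) by exact: measurable_act.
have mU (S : choiceType) (r : seq S) F : (forall z, measurable (F z)) ->
    measurable (\bigcup_(z in [set` r]) F z : set X).
  by move=> mF; rewrite bigcup_seq; exact: bigsetU_measurable.
(* The new cubes consist of [N ^ d] disjoint translates of [A] inside the old uncovered set. *)
have new : pr (uncovered loc') + (N ^ d)%:R * pr A <= pr (uncovered loc).
  pose V := \bigcup_(v in [set` box_enum 0 N]) (T (- v) @^-1` A).
  have VE : V `<=` uncovered loc.
    by move=> x [v /= /cube_box_enum cv Av]; have [] := loc'A _ _ cv Av.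
  have prV : pr V = (N ^ d)%:R * pr A.
    rewrite pr_bigcup_disjoint ?uniq_box_enum //; last first.
      move=> v v' /cube_box_enum cv /cube_box_enum cv' vv'.
      apply/seteqP; split => // x [Av Av'].
      by move: vv'; rewrite (uniqA x v v') ?eqxx.
    rewrite (eq_bigr (fun=> pr A)) => [|v _]; last exact: pr_act.
    by rewrite big_const_seq count_predT iter_addr_0 size_box_enum mulr_natl.
  rewrite -prV -prU //; last 2 first.
  - exact: mU.
  - apply/seteqP; split => // x [/= lx' [v /= /cube_box_enum cv Av]].
    by have [] := loc'A _ _ cv Av; rewrite lx'.
  apply: le_pr => //; first by apply: measurableU => //; exact: mU.
  move=> x [lx'|/VE //].
  case: (loc'E x) => [[q _ e]|[v [_ _ lx _]]|[_ lx _]] //.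
  by have : loc' x = None := lx'; rewrite e.
have left_over : pr (uncovered loc') <=
    ((N + N) ^ d)%:R * pr A + (N ^ d * (d * N))%:R / N'%:R.
  have [Z [mZ Z0 covZ]] := covA.
  have N'0 : (0 < N')%N by exact: leq_trans NN'.
  pose W := \bigcup_(v in [set` box_enum (- N%:Z) (N + N)]) (T v @^-1` A).
  pose F (z : 'I_d * 'I_N) := level loc false z.1 z.2.
  have mF z : measurable (F z) by exact: measurable_level.
  pose B0 := \bigcup_(z in [set` enum {: 'I_d * 'I_N}]) F z.
  have mB0 : measurable B0 by exact: mU.
  pose B := \bigcup_(v in [set` box_enum 0 N]) (T v @^-1` B0).
  have mW : measurable W by exact: mU.
  have mB : measurable B by apply: mU => v; exact: measurable_act.
  have prW : pr W <= ((N + N) ^ d)%:R * pr A.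
    apply: le_trans (pr_bigcup_le _ _ mTA) _.
    rewrite (eq_bigr (fun=> pr A)) => [|v _]; last exact: pr_act.
    by rewrite big_const_seq count_predT iter_addr_0 size_box_enum mulr_natl.
  have prB0 : pr B0 <= (d * N)%:R / N'%:R.
    apply: le_trans (pr_bigcup_le _ _ mF) _.
    apply: le_trans (_ : \sum_(z <- enum {: 'I_d * 'I_N}) N'%:R^-1 <= _).
      by apply: ler_sum => z _; exact: pr_level cs.
    rewrite big_const_seq count_predT iter_addr_0 -cardE card_prod !card_ord.
    by rewrite mulr_natl.
  have prB : pr B <= (N ^ d * (d * N))%:R / N'%:R.
    apply: le_trans (pr_bigcup_le _ _ (fun v => measurable_act v mB0)) _.
    rewrite (eq_bigr (fun=> pr B0)) => [|v _]; last exact: pr_act.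
    rewrite big_const_seq count_predT iter_addr_0 size_box_enum natrM.
    by rewrite -mulrA -[_ *+ _]mulr_natl ler_wpM2l.
  have prZ : pr Z = 0 by rewrite /pr Z0.
  apply: le_trans (_ : pr ((W `|` B) `|` Z) <= _); last first.
    apply: le_trans (prU_le _ _ mZ) _; first exact: measurableU.
    by rewrite prZ addr0 (le_trans (prU_le _ mW mB)) ?lerD.
  apply: le_pr => //; first by apply: measurableU => //; exact: measurableU.
  move=> x lx'; have [nA lx] : ~ inA x /\ loc x = None.
    have {}lx' : loc' x = None := lx'.
    by case: (loc'E x) => [[q _]|[v [_ _ _]]|[]//]; rewrite lx'.
  have [Zx|nZ] := pselect (Z x); first by right.
  left; have [Dx|nD] := pselect (D x).
    have [v sv Av] : exists2 v, small N v & A (T v x).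
      by have := contra_notP (@covZ x) nZ; exact.
    by left; exists v => //=; apply/box_enumP => i; have := sv i; lia.
  right; have [v cv lv] : exists2 v, cube N v & loc (T v x) <> None.
    by apply: contrapT => no; apply: nD => v cv; apply: contrapT => lv; apply: no; exists v.
  exists v; first exact/cube_box_enum.
  case lvE : (loc (T v x)) lv => [[L u]|//] _.
  have [cu {}cl] := cl _ _ _ lvE.
  (* Otherwise [x] itself would be covered. Since [v] is nonnegative, the failure is at a lower
     face, so [u 0 i < v 0 i < N]. *)
  have [i /negP ni] : exists i, ~ (0 <= (u - v) 0 i < L%:Z).
    apply/existsNP => cuv; have := cl (u - v) cuv.
    by rewrite -actD addrAC subrK subrr act0 lx.
  have := cu i; have := cv i; move: ni; rewrite !mxE => ni cvi cui.
  have lN : (`|u 0%R i| < N)%N.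
    by move: (v 0 i) (u 0 i) ni cvi cui => s t; clear; lia.
  exists (i, Ordinal lN); first by rewrite /= mem_enum.
  exists L, u; split=> //=; rewrite /depth.
  by move: (u 0 i) cui => t; clear; lia.
(* Adding [2 ^ d] times [new] to [left_over] eliminates [pr A]. *)
have -> : 2 ^+ d = (2 ^ d)%:R :> R by rewrite natrX.
have e2 : ((N + N) ^ d)%:R = (2 ^ d)%:R * (N ^ d)%:R :> R.
  by rewrite -natrM -expnMn addnn -mul2n.
have : (2 ^ d)%:R * (pr (uncovered loc') + (N ^ d)%:R * pr A) <=
    (2 ^ d)%:R * pr (uncovered loc) by rewrite ler_wpM2l.
rewrite e2 in left_over; lra.
Qed.

Lemma cube_system_le P N N' M loc : (N <= N')%N ->
  cube_system P N' M loc -> cube_system P N M loc.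
Proof.
move=> NN' [mloc cl sz]; split=> // x L v /sz[NL LM PL]; split=> //.
exact: leq_trans NL.
Qed.

Lemma nat_div_le (c e : R) : 0 < e -> exists2 n, (0 < n)%N &
  forall m, (n <= m)%N -> c / m%:R <= e.
Proof.
move=> e0; exists (Num.trunc (c / e)).+1 => // m nm.
have m0 : 0 < m%:R :> R by rewrite ltr0n (leq_trans _ nm).
rewrite ler_pdivrMr // mulrC -ler_pdivrMr // ltW //.
by apply: lt_le_trans (truncnS_gt _) _; rewrite ler_nat.
Qed.

(** Each round multiplies the uncovered part by at most a fixed [s < 1]; a large minimal side then
    makes the boundary part small as well. *)
Lemma cube_system_exists P N m (e : R) : standard_probability mu ->
  free_action mu T -> (0 < P)%N -> 0 < e ->
  exists loc M, cube_system P N M loc /\ pr [set x | ~ deep m (loc x)] <= e.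
Proof.
move=> hst hfree P0 e0.
pose D : R := 2 ^+ d; have D0 : 0 < D by rewrite exprn_gt0.
(* The refinement alone gives the ratio [D / (1 + D)]; the extra [2^-1] pays for an error term of at
   most [s ^+ t / 2]. *)
pose s : R := (D + 2^-1) / (1 + D).
have s0 : 0 < s by rewrite /s divr_gt0 //; lra.
have s1 : s < 1 by rewrite /s ltr_pdivrMr; lra.
(* The minimal side [n] is quantified inside the induction, because earlier rounds need cubes much
   larger than the last one. *)
have H t : forall n, exists loc M,
    cube_system P n M loc /\ pr (uncovered loc) <= s ^+ t.
  elim: t => [|t IH] n.
    exists (fun=> None), 0%N; split; first by split=> //; exact: measurable_partition_cst.
    by rewrite expr0 pr_le1 // /uncovered (_ : [set _ | _] = setT) //; apply/seteqP.
  pose n1 := (P * n.+1)%N.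
  have n10 : (0 < n1)%N by rewrite muln_gt0 P0.
  have n1n : (n <= n1)%N by rewrite /n1; nia.
  have st0 : 0 < s ^+ t / 2 by rewrite divr_gt0 // exprn_gt0.
  have [n2 n20 Hn2] := nat_div_le (n1 ^ d * (d * n1))%:R st0.
  have [loc [M [cs ple]]] := IH (maxn n1 n2).
  have [loc' [cs' ple']] :=
    cube_system_refine hst hfree n10 (leq_maxl n1 n2) (dvdn_mulr _ (dvdnn P)) cs.
  exists loc', (maxn M n1); split; first exact: cube_system_le cs'.
  have Hc := Hn2 _ (leq_maxr n1 n2).
  have Hp : pr (uncovered loc) * D <= s ^+ t * D by rewrite ler_wpM2r // ltW.
  have D1 : 0 < 1 + D by lra.
  rewrite exprSr {2}/s mulrA ler_pdivlMr // [_ ^+ _ * _]mulrDr.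
  apply: le_trans ple' _; exact: lerD.
have [t st] : exists t, s ^+ t <= e / 2.
  have e20 : 0 < e / 2 by rewrite divr_gt0.
  have ns : `|s| < 1 by rewrite gtr0_norm.
  have /cvgrPdist_lt /(_ _ e20) [t _ Ht] := cvg_expr ns.
  exists t; have := Ht t (leqnn t); rewrite /= sub0r normrN => lt.
  by rewrite ltW // (le_lt_trans (ler_norm _)).
have [n n0 Hn] := nat_div_le (2 * d * m)%:R (divr_gt0 e0 (ltr0Sn R 1)).
have [loc [M [cs ple]]] := H t (maxn n N).
exists loc, M; split; first exact: cube_system_le (leq_maxr n N) cs.
have N0 : (0 < maxn n N)%N by rewrite (leq_trans n0) ?leq_maxl.
apply: le_trans (pr_not_deep m N0 cs) _.
have := Hn _ (leq_maxl n N); lra.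
Qed.

End Action.

(** * The limit tiling *)

(** The limit is taken where the sequence is eventually constant, with default [s0] elsewhere. The
    last clause passes to [psi] any property shared by [s0] and all [phi n x]. *)
Lemma eventual_value (disp : measure_display) (X : measurableType disp)
    (S : countType) (s0 : S) (phi : nat -> X -> S) :
  (forall n, measurable_partition (phi n)) ->
  exists psi : X -> S, [/\ measurable_partition psi,
    forall x n, (forall m, (n <= m)%N -> phi m x = phi n x) -> psi x = phi n x &
    forall x, psi x = s0 \/ exists n, psi x = phi n x].
Proof.
move=> mphi; pose ev x s := exists n, forall m, (n <= m)%N -> phi m x = s.
have ev_inj x s s' : ev x s -> ev x s' -> s = s'.
  move=> [n Hn] [n' Hn']; rewrite -(Hn (maxn n n')) ?leq_maxl //.
  by rewrite Hn' ?leq_maxr.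
pose psi x := if pselect (exists s, ev x s) is left h then sval (cid h) else s0.
have psiE x s : ev x s -> psi x = s.
  move=> e; rewrite /psi; case: pselect => [h|[]]; last by exists s.
  by case: cid => s' e' /=; exact: ev_inj e' e.
have psiN x : ~ (exists s, ev x s) -> psi x = s0.
  by rewrite /psi; case: pselect.
have mev s : measurable [set x | ev x s].
  have -> : [set x | ev x s] =
      \bigcup_n \bigcap_(m in [set m | (n <= m)%N]) (phi m @^-1` [set s]).
    apply/seteqP; split => x [n]; first by move=> Hn; exists n.
    by move=> _ Hn; exists n.
  apply: bigcup_measurable => n _.
  by apply: measurable_bigcap_count => m _; exact: mphi.
exists psi; split.
- apply: measurable_partition_count => s.
  have [->|ss0] := eqVneq s s0.
    have -> : [set x | psi x = s0] =
        [set x | ev x s0] `|` ~` \bigcup_(s in [set: S]) [set x | ev x s].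
      apply/seteqP; split => x /=.
        have [[s' e]|ne _] := pselect (exists s, ev x s).
          by rewrite (psiE _ _ e) => <-; left.
        by right => -[s' _ e]; apply: ne; exists s'.
      case=> [/psiE //|ne]; apply: psiN => -[s' e].
      by apply: ne; exists s'.
    apply: measurableU => //; apply: measurableC.
    exact: measurable_bigcup_count.
  rewrite (_ : [set _ | _] = [set x | ev x s]) //.
  apply/seteqP; split => x /=; last exact: psiE.
  have [[s' e]|/psiN ->] := pselect (exists s, ev x s).
    by rewrite (psiE _ _ e) => <-.
  by move=> e; move: ss0; rewrite e eqxx.
- by move=> x n Hn; apply: psiE; exists n.
- move=> x; have [[s e]|/psiN ->] := pselect (exists s, ev x s); last by left.
  right; have [n Hn] := e; exists n.
  by rewrite (psiE _ _ e) Hn.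
Qed.

Theorem theorem2p1 (R : realType) (d k : nat) (hd : (1 <= d)%N) (hk : (2 <= k)%N)
    (w : 'I_k -> 'I_d -> nat)
    (w_gt0 : forall (j : 'I_k) (i : 'I_d), (0 < w j i)%N)
    (w_gcd : forall i : 'I_d, \big[gcdn/0%N]_(j < k) w j i = 1%N)
    (p : 'I_k -> R) (p_gt0 : forall j : 'I_k, 0 < p j)
    (p_sum : \sum_(j < k) p j = 1)
    (disp : measure_display) (X : measurableType disp) (mu : probability X R)
    (hX : lebesgue_probability mu)
    (T : 'rV[int]_d -> X -> X)
    (hT : measure_preserving_action mu T) (hfree : free_action mu T) :
  exists phi : X -> domino_alphabet w,
    [/\ measurable_partition phi,
        {ae mu, forall x, exists2 y, domino_shift w y &
                 forall v : 'rV[int]_d, phi (T v x) = y v} &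
        forall j : 'I_k,
          (mu (\bigcup_(v in [set: box (w j)])
                 phi @^-1` [set domino_cell w (Some j) v])
           < \big[mine/+oo]_(i < k) (p i)%:E)%E].
Proof.
have [e e0 ep] : exists2 e : R, 0 < e & (e%:E < \big[mine/+oo]_(i < k) (p i)%:E)%E.
  have : (0 < \big[mine/+oo]_(i < k) (p i)%:E)%E.
    elim/big_ind: _ => [|a b a0 b0|i _]; rewrite ?ltry ?lte_fin //.
    by rewrite lt_min a0.
  case: (\big[_/_]_(_ < _) _)%E => [r|_|//]; last by exists 1; rewrite ?ltry.
  by rewrite lte_fin => r0; exists (r / 2); rewrite ?lte_fin; lra.
have [hst _] := hX.
pose P := period w; have P0 : (0 < P)%N := period_gt0 w_gt0.
have [C slab] := tileable_slab_large w_gt0 w_gcd.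
(* A multiple of [P] that is at least [C + P], as [tileable_frame] demands. *)
pose K := (P * C.+1)%N.
have PK : (P <= K)%N by rewrite /K; nia.
have CK : (C + P <= K)%N by rewrite /K; nia.
have PdK : (P %| K)%N by exact: dvdn_mulr.
have /choice[fill0 fill0P] : forall Lr : nat * ('I_d -> int), exists y,
    (K + K <= Lr.1)%N -> (P %| Lr.1)%N -> (forall i, 0 <= Lr.2 i < P%:Z) ->
    forall n, (frame w Lr.1 Lr.2 `\` core K Lr.1) n ->
      covered w_gt0 (frame w Lr.1 Lr.2 `\` core K Lr.1) y n.
  move=> [L r] /=.
  have [[KL [PL rP]]|no] :=
      pselect ((K + K <= L)%N /\ (P %| L)%N /\ (forall i, 0 <= r i < P%:Z)).
    by have [y Hy] := tileable_frame slab CK PdK KL PL rP; exists y.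
  by exists (fun=> cell w_gt0 None 0) => KL PL rP; case: no.
pose fill L r := fill0 (L, r).
have /choice[F FP] : forall me : nat * R,
    exists q : (X -> option (nat * 'rV[int]_d)) * nat, 0 < me.2 ->
      cube_system T P (K + K) q.2 q.1 /\
      pr mu [set x | ~ deep me.1 (q.1 x)] <= me.2.
  move=> [m r] /=; have [r0|_] := ltP 0 r; last by exists (fun=> None, 0%N).
  have [loc [M H]] := cube_system_exists hT (K + K) m hst hfree P0 r0.
  by exists (loc, M).
(* Stage 0 has no cubes. Stage [n + 1] asks for depth [M n + K], so that a cube of stage [n] around
   a deep point is nested; the exceptional probabilities sum to [e]. *)
pose st := fix st n := if n is n'.+1 then F ((st n').2 + K, e / (2 ^ n'.+1)%:R)%N
  else (fun=> None, 0%N).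
pose loc n := (st n).1; pose M n := (st n).2.
have en0 n : 0 < e / (2 ^ n.+1)%:R by rewrite divr_gt0 // ltr0n expn_gt0.
have cs n : cube_system T P (K + K) (M n) (loc n).
  case: n => [|n]; first by split=> //; exact: measurable_partition_cst.
  by have [] := FP (M n + K, e / (2 ^ n.+1)%:R)%N (en0 n).
pose bad n := [set x | ~ deep (M n + K) (loc n.+1 x)].
have badP n : pr mu (bad n) <= e / (2 ^ n.+1)%:R.
  by have [] := FP (M n + K, e / (2 ^ n.+1)%:R)%N (en0 n).
have mbad n : measurable (bad n).
  by have [mloc _ _] := cs n.+1; exact: (mloc [set q | ~ deep (M n + K) q]).
have sum_bad : (\sum_(0 <= n <oo) mu (bad n) <= e%:E)%E.
  apply: le_trans (epsilon_trick0 xpredT (ltW e0)).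
  by apply: lee_nneseries => // n _; rewrite prE // lee_fin.
have K_deep n q : deep (M n + K) q -> deep K q.
  by case: q => // -[L v] /= vc i; have := vc i; lia.
pose phi := fix phi n x := if n is n'.+1 then
    refine w_gt0 K fill (loc n' x) (loc n x) (phi n' x)
  else cell w_gt0 None 0.
have mphi n : measurable_partition (phi n).
  elim: n => [|n IH]; first exact: measurable_partition_cst.
  have [mn _ _] := cs n; have [mn1 _ _] := cs n.+1.
  apply: (measurable_partition_comp
    (f := fun x => ((loc n x, loc n.+1 x), phi n x))
    (fun q => refine w_gt0 K fill q.1.1 q.1.2 q.2)).
  by apply: measurable_partition_pair IH; exact: measurable_partition_pair.
have cons n x : cubes_consistent (fun v => loc n (T v x)).
  move=> v L u lv; have [_ /(_ _ _ _ lv)[cu cl] _] := cs n; split=> // u' /cl.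
  by rewrite -(actD hT) addrAC [u' + v]addrC addrAC.
have tiled n x : core_tiled w_gt0 K (fun v => loc n (T v x)) (fun v => phi n (T v x)).
  elim: n => [|n IH]; first by [].
  apply: refine_core_tiled IH => //.
  - by move=> L r; exact: (fill0P (L, r)).
  - by move=> v L u lv; have [_ _ /(_ _ _ _ lv)[]] := cs n.
  - by move=> v L u lv; have [_ _ /(_ _ _ _ lv)[]] := cs n.+1.
(* The translate of [z] by [t] lies in the core of the stage [n] cube containing [z]. *)
pose region n z (t : 'rV[int]_d) := exists L v, loc n z = Some (L, v) /\ core K L (v + t).
have region_step n z t : ~ bad n z -> region n z t ->
    region n.+1 z t /\ phi n.+1 (T t z) = phi n (T t z).
  have locT i L v : loc i z = Some (L, v) -> cube L (v + t) ->
      loc i (T t z) = Some (L, v + t).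
    have [_ cl _] := cs i => /cl[_ {}cl] /cl.
    by rewrite addrAC subrr add0r.
  move=> /contrapT; case e1 : (loc n.+1 z) => [[L' v']|//] /= cv'.
  move=> [L [v [e2 cvt]]].
  have [_ _ /(_ _ _ _ e2)[_ LM _]] := cs n.
  have [_ /(_ _ _ _ e2)[cv _] _] := cs n.
  (* The inner side is at most [M n], and [z] is [M n + K] deep in the outer cube. *)
  have ne : nested K L L' (v' - v).
    apply/forallP => i; have := cv' i; have := cv i; rewrite !mxE.
    by move: (v 0 i) (v' 0 i) LM => a b; clear; lia.
  have cvt' : core K L' (v' + t).
    move=> i; have /forallP/(_ i) := ne; have := cvt i; rewrite !mxE.
    by move: (v 0 i) (v' 0 i) (t 0 i) => a b c; clear; lia.
  split; first by exists L', v'.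
  rewrite /= (locT _ _ _ e1 (core_cube cvt')) (locT _ _ _ e2 (core_cube cvt)).
  by rewrite /refine opprD addrACA subrr addr0 ne mem_set.
have [psi [mpsi psiE psiV]] := eventual_value (cell w_gt0 None 0) mphi.
exists psi; split => //.
(* Borel-Cantelli. *)
- have : {ae mu, forall x, exists n, forall m, (n <= m)%N -> ~ bad m x}.
    exists (lim_sup_set bad); split.
    + by apply: measurable_bigcap_count => n _; exact: bigcup_measurable.
    + by apply: lim_sup_set_cvg0 => //; apply: le_lt_trans sum_bad _; rewrite ltry.
    + move=> x /= nx n _; apply: contrapT => no; apply: nx; exists n => m nm bm.
      by apply: no; exists m.
  move/(ae_orbit hT); apply: filterS => x evx.
  exists (fun v => psi (T v x)) => //; apply: (covered_shift (w_gt0 := w_gt0)) => n.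
  have [m0 Hm] := evx n; set z := T n x in Hm.
  (* [~ bad m0] concerns the cube of stage [m0 + 1]: its core contains [z], and no later stage
     changes the symbols on that core. *)
  pose m := m0.+1.
  have stab t : region m z t -> psi (T t z) = phi m (T t z).
    move=> rt; apply: psiE => l /subnK <-.
    suff : region (l - m + m)%N z t /\ phi (l - m + m)%N (T t z) = phi m (T t z) by case.
    elim: (l - m)%N => [//|i [ri <-]]; rewrite addSn.
    by apply: region_step => //; apply: Hm; rewrite /m; lia.
  have := contrapT (Hm m0 (leqnn m0)) => /K_deep.
  case e1 : (loc m0.+1 z) => [[L v]|//] /= vc.
  apply: covered_sub (tiled m x n L v e1 vc); first by [].
  move=> l; rewrite inE /= => lc.
  have -> : T l x = T (l - n) z by rewrite -(actD hT) subrK.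
  rewrite stab //; exists L, v; split=> //.
  by rewrite addrC -addrA [_ + v]addrC -opprB.
- move=> j; apply: le_lt_trans ep.
  apply: le_trans sum_bad.
  apply: measure_sigma_subadditive => //.
    by rewrite -preimage_bigcup; exact: mpsi.
  move=> x [v _ /= xv]; apply: contrapT => nb.
  have nbad n : ~ bad n x by move=> bn; apply: nb; exists n.
  (* If [x] is never bad, it lies in the core of its cube at each stage from 1 on. Hence [refine]
     keeps the previous symbol or writes a large domino, and never calls [fill]. *)
  suff tagN n : tag (phi n x) = None.
    have : tag (psi x) = None by case: (psiV x) => [->|[n ->]].
    by rewrite xv.
  elim: n => [//|n IH] /=.
  case: (loc n.+1 x) => [[L' v']|]; last by case: (loc n x) => [[]|].
  case: n IH => [//|n] IH; have := contrapT (nbad n) => /K_deep.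
  case: (loc n.+1 x) => [[L u]|//] /= uc.
  by rewrite (mem_set uc) andbT; case: ifP => [_|-> //]; exact: IH.
Qed.
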